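(* Let $\varphi\in L^2(\mathscr G)$ be a function with compact support such that $\mathcal E^\Gamma(\varphi)$ is an $\mathcal S^\Gamma(\varphi)$-subspace Riesz basis. If there exists a function $\psi\in L^2(\mathscr G)$ such that $\mathcal E^\Gamma(\psi)$ is biorthogonal to $\mathcal E^\Gamma(\varphi)$, then $\mathcal E^\Gamma(\psi)$ is an $\mathcal S^\Gamma(\varphi)$-subspace dual to $\mathcal E^\Gamma(\varphi)$. Moreover, $\mathcal E^\Gamma(\psi)$ is also an $\mathcal S^\Gamma(\psi)$-subspace Riesz basis.
   Context: $\mathscr G$ is a second countable locally compact group (not necessarily abelian) with left Haar measure and $\Gamma$ is a closed discrete abelian subgroup with counting measure. $(L_\gamma f)(x)=f(\gamma^{-1}x)$, $\mathcal E^\Gamma(\varphi)=\{L_\gamma\varphi\}_{\gamma\in\Gamma}$, $\mathcal S^\Gamma(\varphi)=\overline{\operatorname{span}}\,\mathcal E^\Gamma(\varphi)$ in $L^2(\mathscr G)$. For non-zero $\varphi,\psi\in L^2(\mathscr G)$, $\mathcal E^\Gamma(\varphi)$ and $\mathcal E^\Gamma(\psi)$ are biorthogonal if $\langle L_\gamma\varphi,L_{\gamma'}\psi\rangle=\delta_{\gamma,\gamma'}$ for all $\gamma,\gamma'\in\Gamma$. A countable family $\{f_k\}$ in a Hilbert space $\mathcal H$ is Bessel if $\sum_k|\langle f,f_k\rangle|^2\le B\|f\|^2$ for all $f\in\mathcal H$ and some $B<\infty$. For a closed subspace $\mathcal K$ of $\mathcal H$, $\{f_k\}$ is a $\mathcal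 K$-subspace frame if there are $0<A\le B<\infty$ with $A\|f\|^2\le\sum_k|\langle f,f_k\rangle|^2\le B\|f\|^2$ for all $f\in\mathcal K$. For two Bessel families $\{f_k\}$ and $\{g_k\}$ in $\mathcal H$, $\{g_k\}$ is called a $\mathcal K$-subspace dual to $\{f_k\}$ if $\sum_k\langle f,g_k\rangle f_k=f$ for all $f\in\mathcal K$. $\mathcal E^\Gamma(\varphi)$ is an $\mathcal S^\Gamma(\varphi)$-subspace Riesz basis if it is an $\mathcal S^\Gamma(\varphi)$-subspace frame and is linearly independent, meaning that $\sum_{\gamma}c_\gamma L_\gamma\varphi=0$ with $\{c_\gamma\}\in\ell^2(\Gamma)$ implies $c_\gamma=0$ for all $\gamma$. Equivalently, there are $0<A\le B<\infty$ with $A\sum_\gamma|c_\gamma|^2\le\|\sum_\gamma c_\gamma L_\gamma\varphi\|^2\le B\sum_\gamma|c_\gamma|^2$ for all sequences $\{c_\gamma\}_{\gamma\in\Gamma}$ with finitely many non-zero terms.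
   Formalization: The expansion of every f in S^Γ(φ) is proved as stated; the dual property (with both families Bessel) and the Riesz basis property of E^Γ(ψ) are proved under the added, necessary assumption that E^Γ(ψ) is Bessel, without which they fail. *)

(* Defs.v *)
From HB Require Import structures.
From mathcomp Require Import all_boot all_order all_algebra finmap.
From mathcomp Require Import complex.
From mathcomp Require Import all_classical all_reals all_analysis.

Set Implicit Arguments.
Unset Strict Implicit.
Unset Printing Implicit Defensive.

Import Order.TTheory GRing.Theory Num.Theory.

Local Open Scope classical_set_scope.
Local Open Scope complex_scope.
Local Open Scope ring_scope.

(* The distinguished point inherited from [PointedTopological] plays no role:
   the library only builds [g_sigma_algebraType] on pointed types. *)
HB.mixin Record PointedTopological_isTopGroup G
    of Group G & PointedTopological G := {
  mulg_continuous : continuous (fun x : G * G => (x.1 * x.2)%g) ;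
  invg_continuous : continuous (fun x : G => (x^-1)%g)
}.

#[short(type="topGroupType")]
HB.structure Definition TopGroup :=
  {G of Group G & PointedTopological G & PointedTopological_isTopGroup G}.

Definition borelType (G : topGroupType) := g_sigma_algebraType (@open G).

(* Second countable locally compact groups are Hausdorff by convention. *)
Definition sc_lc_group (G : topGroupType) : Prop :=
  [/\ hausdorff_space G, locally_compact [set: G] & @second_countable G].

(* A nonzero left-invariant Radon measure on the Borel sets. *)
Record left_haar (R : realType) (G : topGroupType)
    (mu : {measure set (borelType G) -> \bar R}) : Prop := LeftHaar {
  haar_nonzero : mu setT != 0%E ;
  haar_left_invariant : forall (g : G) (A : set (borelType G)), measurable A ->
    mu [set (g * x)%g | x in A] = mu A ;
  haar_compact : forall K : set G, compact K -> (mu K < +oo)%E ;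
  haar_outer_regular : forall A : set (borelType G), measurable A ->
    mu A = ereal_inf [set mu U | U in [set U : set G | open U /\ A `<=` U]] ;
  haar_inner_regular : forall U : set G, open U ->
    mu U = ereal_sup [set mu K | K in [set K : set G | compact K /\ K `<=` U]]
}.

Record closed_discrete_abelian_subgroup (G : topGroupType) (Gam : set G)
    : Prop := ClosedDiscreteAbelianSubgroup {
  subgroup1 : Gam 1%g ;
  subgroupM : forall a b, Gam a -> Gam b -> Gam (a * b)%g ;
  subgroupV : forall a, Gam a -> Gam (a^-1)%g ;
  subgroup_closed : closed Gam ;
  subgroup_discrete : forall a, Gam a ->
    exists2 U : set G, open U & U `&` Gam = [set a] ;
  subgroup_abelian : forall a b, Gam a -> Gam b -> (a * b)%g = (b * a)%g
}.

(* Elements of the complex Hilbert space L^2(mu) are handled through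
   representatives T -> R[i]; two representatives of the same class are at
   L2norm-distance 0, and no notion below distinguishes them. *)
Section L2.
Context (R : realType) (d : measure_display) (T : measurableType d)
  (mu : {measure set T -> \bar R}).

Local Notation normc := ComplexField.Normc.normc.

Definition L2 : set (T -> R[i]) := [set f : T -> R[i] |
  [/\ measurable_fun [set: T] (fun x => complex.Re (f x)),
      measurable_fun [set: T] (fun x => complex.Im (f x)) &
      (\int[mu]_x (normc (f x) ^+ 2)%:E < +oo)%E]].

Definition L2norm (f : T -> R[i]) : R :=
  Num.sqrt (\int[mu]_x (normc (f x) ^+ 2))%R.

Definition L2inner (f g : T -> R[i]) : R[i] :=
  (\int[mu]_x complex.Re (f x * (g x)^*%C))%R +i*
  (\int[mu]_x complex.Im (f x * (g x)^*%C))%R.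

(* Families are indexed by the elements of a set D of a type I. *)
Context (I : choiceType) (D : set I).
Implicit Types (F : I -> T -> R[i]) (K : set (T -> R[i])).

Definition fsum (J : {fset I}) (c : I -> R[i]) F : T -> R[i] :=
  fun x => \sum_(k <- J) c k * F k x.

Definition lin_span F : set (T -> R[i]) :=
  [set h : T -> R[i] | exists2 J : {fset I}, [set` J] `<=` D & exists c, h = fsum J c F].

Definition closed_span F : set (T -> R[i]) := [set h : T -> R[i] | L2 h /\
  forall e : R, 0 < e -> exists2 g, lin_span F g & L2norm (h \- g) < e].

(* sum_(k in D) c_k F_k = h, the limit in L^2 of the net of finite partial
   sums (unconditional convergence). *)
Definition has_L2sum (c : I -> R[i]) F (h : T -> R[i]) : Prop :=
  forall e : R, 0 < e ->
  exists2 J0 : {fset I}, [set` J0] `<=` D &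
    forall J : {fset I}, [set` J0] `<=` [set` J] -> [set` J] `<=` D ->
      L2norm (h \- fsum J c F) < e.

(* sum_(k in D) |c_k|^2 *)
Definition l2sum (c : I -> R[i]) : \bar R :=
  (\esum_(k in D) (normc (c k) ^+ 2)%:E)%E.

Definition bessel F : Prop := exists B : R, forall f, L2 f ->
  (l2sum (fun k => L2inner f (F k)) <= (B * L2norm f ^+ 2)%:E)%E.

Definition subspace_frame K F : Prop := exists A B : R,
  [/\ 0 < A, A <= B & forall f, K f ->
    ((A * L2norm f ^+ 2)%:E <= l2sum (fun k => L2inner f (F k)))%E /\
    (l2sum (fun k => L2inner f (F k)) <= (B * L2norm f ^+ 2)%:E)%E].

(* sum_k <f, G_k> F_k = f on K. *)
Definition dual_expansion K F G : Prop := forall f, K f ->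
  has_L2sum (fun k => L2inner f (G k)) F f.

(* G is a K-subspace dual to F.  The notion is defined for pairs of Bessel
   families only; a family biorthogonal to F need not be Bessel. *)
Definition subspace_dual K F G : Prop :=
  [/\ bessel F, bessel G & dual_expansion K F G].

Definition l2_independent F : Prop := forall c : I -> R[i],
  (l2sum c < +oo)%E -> has_L2sum c F (fun=> 0) -> forall k, D k -> c k = 0.

Definition subspace_riesz_basis F : Prop :=
  subspace_frame (closed_span F) F /\ l2_independent F.

Definition biorthogonal F G : Prop := forall j k, D j -> D k ->
  L2inner (F j) (G k) = (j == k)%:R.

End L2.

Section Translation.
Context (R : realType) (G : topGroupType).

Definition ltrans (a : G) (f : G -> R[i]) : G -> R[i] :=
  fun x => f (a^-1 * x)%g.

(* E^Gamma(f) as a family indexed by the elements of Gamma. *)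
Definition orbit_family (f : G -> R[i]) : G -> borelType G -> R[i] :=
  fun a => ltrans a f.

(* S^Gamma(f) *)
Definition translate_space (mu : {measure set (borelType G) -> \bar R})
    (Gam : set G) (f : G -> R[i]) : set (borelType G -> R[i]) :=
  closed_span mu Gam (orbit_family f).

(* Compact support of an L^2-class: the function vanishes almost everywhere
   outside some compact set. *)
Definition compactly_supported (mu : {measure set (borelType G) -> \bar R})
    (f : G -> R[i]) : Prop :=
  exists2 K : set G, compact K & {ae mu, forall x, ~ K x -> f x = 0}.

End Translation.

(* Main.v *)
Require Import Defs.
From HB Require Import structures.
From mathcomp Require Import all_boot all_order all_algebra finmap.
From mathcomp Require Import complex.
From mathcomp Require Import all_classical all_reals all_analysis.
From mathcomp Require Import measurable_realfun ring lra.

Import Order.TTheory GRing.Theory Num.Theory.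
Import numFieldNormedType.Exports.

Local Open Scope classical_set_scope.
Local Open Scope ring_scope.

(* Let A <= B be frame bounds of F = E^Gamma(phi), and let G = E^Gamma(psi).
   For f in the closed span K of F, subtracting B^-1 sum_(k in J) <f, F_k> F_k
   for a large finite J multiplies |f|^2 by at most 1 - A / (2 B) and stays in
   K, while the subtracted term has controlled coefficients against G.  Iterating, the analysis map of G is
   bounded on K: sum_k |<f, G_k>|^2 <= C |f|^2.  The expansion
   f = sum_k <f, G_k> F_k holds for finite combinations of F by
   biorthogonality, hence on K by this bound and the boundedness of the
   synthesis map of F.  For G, pairing with F_k gives independence; and
   |g|^2 <= B sum_k |<g, G_k>|^2 on finite combinations g of G, because their
   coefficients <g, F_k> satisfy the Bessel bound of F. *)

(** * Squared modulus of a complex number *)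

Section ComplexModulus.
Context {R : rcfType}.
Implicit Types z w : R[i].

(** Free of square roots, so that inequalities between squared moduli become polynomial ones in the
    coordinates. *)
Definition abs2 z : R := complex.Re z ^+ 2 + complex.Im z ^+ 2.

Lemma sqr_normc z : ComplexField.Normc.normc z ^+ 2 = abs2 z.
Proof. by case: z => a b /=; rewrite sqr_sqrtr// addr_ge0// sqr_ge0. Qed.

Lemma abs2_ge0 z : 0 <= abs2 z.
Proof. by rewrite /abs2 addr_ge0// sqr_ge0. Qed.

Lemma abs2_conj z : abs2 (z^*)%C = abs2 z.
Proof. by case: z => a b; rewrite /abs2/= sqrrN. Qed.

Lemma abs2_le0 z : abs2 z <= 0 -> z = 0.
Proof.
case: z => a b; rewrite /abs2/= => h; apply/eqP; rewrite eq_complex/=.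
have a0 := sqr_ge0 a; have b0 := sqr_ge0 b.
by apply/andP; split; rewrite -sqrf_eq0; apply/eqP; lra.
Qed.

(** The right side minus the left side is [s^-1] times the squared modulus of [s z - w]. *)
Lemma abs2D_le (s : R) z w : 0 < s ->
  abs2 (z + w) <= (1 + s) * abs2 z + (1 + s^-1) * abs2 w.
Proof.
case: z => a b; case: w => c d s0; rewrite /abs2/= -subr_ge0.
suff -> : (1 + s) * (a ^+ 2 + b ^+ 2) + (1 + s^-1) * (c ^+ 2 + d ^+ 2) -
    ((a + c) ^+ 2 + (b + d) ^+ 2) =
    s^-1 * ((s * a - c) ^+ 2 + (s * b - d) ^+ 2).
  rewrite mulr_ge0 ?invr_ge0 ?(ltW s0)//.
  by apply: addr_ge0; apply: sqr_ge0.
by field; rewrite gt_eqF.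
Qed.

(** The difference of the two sides is the squared modulus of [t z] minus the conjugate of [w]. *)
Lemma young_complex (t : R) z w :
  t *+ 2 * complex.Re (z * w) <= t ^+ 2 * abs2 z + abs2 w.
Proof.
case: z => a b; case: w => c d; rewrite /abs2/= -subr_ge0.
suff -> : t ^+ 2 * (a ^+ 2 + b ^+ 2) + (c ^+ 2 + d ^+ 2) -
    t *+ 2 * (a * c - b * d) = (t * a - c) ^+ 2 + (t * b + d) ^+ 2.
  by rewrite addr_ge0// sqr_ge0.
ring.
Qed.

End ComplexModulus.

(** * Square-integrable complex functions, through their real and imaginary parts *)

Section L2Space.
Context {R : realType} {d : measure_display} {T : measurableType d}
  {mu : {measure set T -> \bar R}}.
Implicit Types f g h : T -> R[i].

Local Notation Re := complex.Re.
Local Notation Im := complex.Im.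
Local Notation integrable u :=
  (mu.-integrable [set: T] (EFin \o (u : T -> R) : T -> \bar R)).
Local Notation "<[ f , g ]>" := (L2inner mu f g).

Definition sq_integrable (u : T -> R) :=
  measurable_fun [set: T] u /\ integrable (fun x => u x ^+ 2).

Lemma integrableD_fin {u v : T -> R} :
  integrable u -> integrable v -> integrable (fun x => u x + v x).
Proof.
move=> iu iv; have := integrableD measurableT iu iv.
by apply: eq_integrable => // x _.
Qed.

Lemma integrableZl_fin (c : R) {u : T -> R} :
  integrable u -> integrable (fun x => c * u x).
Proof.
move=> iu; have := integrableZl measurableT c iu.
by apply: eq_integrable => // x _.
Qed.

(** The product is dominated by [u ^+ 2 + v ^+ 2]. *)
Lemma sq_integrableM {u v : T -> R} :
  sq_integrable u -> sq_integrable v -> integrable (fun x => u x * v x).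
Proof.
move=> [mu_u iu] [mv iv].
apply: (le_integrable measurableT _ _ (integrableD_fin iu iv)) => //.
  by apply/measurable_EFinP; exact: measurable_funM.
move=> x _ /=; rewrite lee_fin normrM [leRHS]ger0_norm ?addr_ge0 ?sqr_ge0//.
rewrite -(real_normK (num_real (u x))) -(real_normK (num_real (v x))).
have h := sqr_ge0 (`|u x| - `|v x|).
have h1 := sqr_ge0 `|u x|; have h2 := sqr_ge0 `|v x|; lra.
Qed.

Lemma sq_integrableD {u v : T -> R} : sq_integrable u -> sq_integrable v ->
  sq_integrable (fun x => u x + v x).
Proof.
move=> su sv; split; first exact: measurable_funD su.1 sv.1.
have := integrableD_fin (integrableD_fin su.2 sv.2)
  (integrableZl_fin 2 (sq_integrableM su sv)).
by apply: eq_integrable => // x _ /=; congr EFin; ring.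
Qed.

Lemma sq_integrableZ (c : R) {u : T -> R} : sq_integrable u ->
  sq_integrable (fun x => c * u x).
Proof.
move=> su; split; first exact: measurable_funM (measurable_cst _) su.1.
have := integrableZl_fin (c ^+ 2) su.2.
by apply: eq_integrable => // x _ /=; congr EFin; ring.
Qed.

Lemma L2P f : L2 mu f <->
  sq_integrable (fun x => Re (f x)) /\ sq_integrable (fun x => Im (f x)).
Proof.
have sum2 : (fun x => (ComplexField.Normc.normc (f x) ^+ 2)%:E) =
    (EFin \o (fun x => Re (f x) ^+ 2 + Im (f x) ^+ 2 : R) : T -> \bar R).
  by apply/funext => x /=; rewrite sqr_normc.
split=> [[mr mi fin]|[[mr ir] [mi ii]]]; last first.
  split=> //; rewrite sum2.
  have /integrableP[_] := integrableD_fin ir ii.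
  apply: le_lt_trans; apply: ge0_le_integral => //=.
  - by move=> x _; rewrite lee_fin addr_ge0// sqr_ge0.
  - by apply/measurable_EFinP; apply: measurable_funD; exact: measurable_funX.
  - by apply/measurable_EFinP; apply: measurableT_comp => //;
      apply: measurable_funD; exact: measurable_funX.
  - by move=> x _; rewrite lee_fin ler_norm.
rewrite sum2 in fin.
have m2 : measurable_fun [set: T]
    (EFin \o (fun x => Re (f x) ^+ 2 + Im (f x) ^+ 2 : R) : T -> \bar R).
  by apply/measurable_EFinP; apply: measurable_funD; exact: measurable_funX.
have i2 : integrable (fun x => Re (f x) ^+ 2 + Im (f x) ^+ 2).
  apply/integrableP; split => //.
  rewrite (eq_integral (EFin \o (fun x => Re (f x) ^+ 2 + Im (f x) ^+ 2)))//.
  by move=> x _ /=; rewrite ger0_norm// addr_ge0// sqr_ge0.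
split; split=> //; apply: (le_integrable measurableT _ _ i2) => //.
- by apply/measurable_EFinP; exact: measurable_funX.
- by move=> x _ /=; rewrite lee_fin !ger0_norm ?addr_ge0 ?sqr_ge0//
    lerDl sqr_ge0.
- by apply/measurable_EFinP; exact: measurable_funX.
- by move=> x _ /=; rewrite lee_fin !ger0_norm ?addr_ge0 ?sqr_ge0//
    lerDr sqr_ge0.
Qed.

Lemma L2D {f g} : L2 mu f -> L2 mu g -> L2 mu (fun x => f x + g x).
Proof.
move=> /L2P[fr fi] /L2P[gr gi]; apply/L2P; split.
- by have := sq_integrableD fr gr; congr sq_integrable; apply/funext => x;
    case: (f x) (g x) => ? ? [].
- by have := sq_integrableD fi gi; congr sq_integrable; apply/funext => x;
    case: (f x) (g x) => ? ? [].
Qed.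

Lemma L2Z (c : R[i]) {f} : L2 mu f -> L2 mu (fun x => c * f x).
Proof.
case: c => a b /L2P[fr fi]; apply/L2P; split.
- have := sq_integrableD (sq_integrableZ a fr) (sq_integrableZ (- b) fi).
  by congr sq_integrable; apply/funext => x; case: (f x) => ? ? /=; ring.
- have := sq_integrableD (sq_integrableZ a fi) (sq_integrableZ b fr).
  by congr sq_integrable; apply/funext => x; case: (f x) => ? ? /=; ring.
Qed.

Lemma L2_0 : L2 mu (fun=> 0).
Proof.
by apply/L2P; split; split=> //=; rewrite expr0n/=; exact: integrable0.
Qed.

Lemma L2B {f g} : L2 mu f -> L2 mu g -> L2 mu (f \- g).
Proof.
move=> Lf Lg; have := L2D Lf (L2Z (-1) Lg).
by congr (L2 mu); apply/funext => x /=; rewrite mulN1r.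
Qed.

Lemma integrable_conjM {f g} : L2 mu f -> L2 mu g ->
  integrable (fun x => Re (f x * (g x)^*%C)) /\
  integrable (fun x => Im (f x * (g x)^*%C)).
Proof.
move=> /L2P[fr fi] /L2P[gr gi]; split.
- have := integrableD_fin (sq_integrableM fr gr) (sq_integrableM fi gi).
  by apply: eq_integrable => // x _ /=; case: (f x) (g x) => ? ? [? ?] /=;
    congr EFin; ring.
- have := integrableD_fin (sq_integrableM fi gr)
    (integrableZl_fin (-1) (sq_integrableM fr gi)).
  by apply: eq_integrable => // x _ /=; case: (f x) (g x) => ? ? [? ?] /=;
    congr EFin; ring.
Qed.

Lemma L2innerDl {f g h} : L2 mu f -> L2 mu g -> L2 mu h ->
  <[fun x => f x + g x, h]> = <[f, h]> + <[g, h]>.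
Proof.
move=> Lf Lg Lh; have [r1 i1] := integrable_conjM Lf Lh.
have [r2 i2] := integrable_conjM Lg Lh.
rewrite /L2inner; apply/eqP; rewrite eq_complex/=; apply/andP; split; apply/eqP.
  rewrite -RintegralD//; apply: eq_Rintegral => x _.
  by case: (f x) (g x) (h x) => ? ? [? ?] [? ?] /=; ring.
rewrite -RintegralD//; apply: eq_Rintegral => x _.
by case: (f x) (g x) (h x) => ? ? [? ?] [? ?] /=; ring.
Qed.

Lemma L2innerZl (c : R[i]) {f h} : L2 mu f -> L2 mu h ->
  <[fun x => c * f x, h]> = c * <[f, h]>.
Proof.
case: c => a b Lf Lh; have [r1 i1] := integrable_conjM Lf Lh.
rewrite /L2inner; apply/eqP; rewrite eq_complex/=; apply/andP; split; apply/eqP.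
  rewrite -!RintegralZl// -RintegralB//; try exact: integrableZl_fin.
  by apply: eq_Rintegral => x _; case: (f x) (h x) => ? ? [? ?] /=; ring.
rewrite -!RintegralZl// -RintegralD//; try exact: integrableZl_fin.
by apply: eq_Rintegral => x _; case: (f x) (h x) => ? ? [? ?] /=; ring.
Qed.

Lemma L2innerC {f g} : L2 mu f -> L2 mu g -> <[g, f]> = (<[f, g]>^*)%C.
Proof.
move=> Lf Lg; have [r1 i1] := integrable_conjM Lf Lg.
rewrite /L2inner; apply/eqP; rewrite eq_complex/=; apply/andP; split; apply/eqP.
  by apply: eq_Rintegral => x _; case: (f x) (g x) => ? ? [? ?] /=; ring.
rewrite -mulN1r -RintegralZl//.
by apply: eq_Rintegral => x _; case: (f x) (g x) => ? ? [? ?] /=; ring.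
Qed.

Lemma L2normE f : L2norm mu f ^+ 2 = Re <[f, f]>.
Proof.
rewrite /L2norm sqr_sqrtr; last by apply: Rintegral_ge0 => x _; exact: sqr_ge0.
rewrite /L2inner/=; apply: eq_Rintegral => x _; rewrite sqr_normc.
by case: (f x) => ? ?; rewrite /abs2/=; ring.
Qed.

End L2Space.

(** * Real inequalities obtained from arbitrarily small errors *)

Section SmallSquares.
Context {R : realType}.

Lemma exists_sqr_lt (m x : R) : 0 <= m -> 0 < x ->
  exists2 e, 0 < e & m * e ^+ 2 < x.
Proof.
move=> m0 x0; exists (x / (1 + x + m)); first by rewrite divr_gt0//; lra.
have p0 : 0 < 1 + x + m by lra.
rewrite expr_div_n mulrA ltr_pdivrMr ?exprn_gt0//.
rewrite expr2 mulrCA -subr_gt0 -mulrBr mulr_gt0//.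
have := mulr_ge0 m0 (ltW x0); nra.
Qed.

Lemma le0_sqr (m x : R) : 0 <= m ->
  (forall e, 0 < e -> x <= m * e ^+ 2) -> x <= 0.
Proof.
move=> m0 H; rewrite leNgt; apply/negP => x0.
by have [e e0] := exists_sqr_lt m x m0 x0; rewrite ltNge H.
Qed.

Lemma le0_geometric (r m x : R) : 0 <= r < 1 ->
  (forall n, x <= r ^+ n * m) -> x <= 0.
Proof.
move=> /andP[r0 r1] H.
have c : r ^+ n * m @[n --> \oo] --> 0.
  rewrite -(mul0r m); apply: cvgMl; apply: cvg_expr.
  by rewrite ger0_norm.
by apply: cvgr_to_ge c _; apply: nearW.
Qed.

(* Nonnegativity of [a - 2 t b + t^2 b c] at the minimiser [t = 1 / c]. *)
Lemma le_of_quadratic (a b c : R) : 0 <= b -> 0 <= c ->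
  (forall t, 0 <= a - t *+ 2 * b + t ^+ 2 * b * c) -> b <= a * c.
Proof.
move=> b0 c0 H; have [c00|cn0] := eqVneq c 0.
  rewrite c00 mulr0 leNgt; apply/negP => bp.
  (* With [c = 0] the expression is affine in [t]; this [t] gives it the value -1. *)
  have := H ((a + 1) / (b *+ 2)); rewrite c00 mulr0 addr0.
  suff -> : a - ((a + 1) / (b *+ 2)) *+ 2 * b = -1 by lra.
  by field; rewrite gt_eqF.
have cp : 0 < c by rewrite lt_def cn0.
rewrite -ler_pdivrMr//.
have := H c^-1; suff -> : a - c^-1 *+ 2 * b + c^-1 ^+ 2 * b * c = a - b / c.
  by rewrite subr_ge0.
by field.
Qed.

End SmallSquares.

(** * Norm expansions and the Cauchy-Schwarz inequality *)

Section InnerProduct.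
Context {R : realType} {d : measure_display} {T : measurableType d}
  {mu : {measure set T -> \bar R}}.
Implicit Types f g h : T -> R[i].

Local Notation Re := complex.Re.
Local Notation "<[ f , g ]>" := (L2inner mu f g).
Local Notation sqn f := (L2norm mu f ^+ 2).

Lemma L2innerBl {f g h} : L2 mu f -> L2 mu g -> L2 mu h ->
  <[f \- g, h]> = <[f, h]> - <[g, h]>.
Proof.
move=> Lf Lg Lh; have -> : f \- g = (fun x => f x + (-1) * g x).
  by apply/funext => x /=; rewrite mulN1r.
by rewrite L2innerDl ?L2innerZl ?mulN1r//; exact: L2Z.
Qed.

Lemma L2norm_sqr_subZ (c : R[i]) {f g} : L2 mu f -> L2 mu g ->
  sqn (f \- (fun x => c * g x)) =
  sqn f - 2 * Re (c^*%C * <[f, g]>) + abs2 c * sqn g.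
Proof.
move=> Lf Lg; have Lcg := L2Z c Lg; have LB := L2B Lf Lcg.
rewrite L2normE L2innerBl// (L2innerC LB Lf) (L2innerC LB Lcg).
rewrite !L2innerBl// !L2innerZl// (L2innerC Lcg Lf) L2innerZl//.
rewrite (L2innerC Lcg Lg) L2innerZl// (L2innerC Lf Lg) !L2normE.
rewrite (L2innerC Lg Lg) (L2innerC Lf Lf).
case: c {Lcg LB} => a b; case: <[f, f]> => a1 b1; case: <[g, g]> => a2 b2.
by case: <[f, g]> => a3 b3; rewrite /abs2 /=; ring.
Qed.

Lemma L2norm_sqrB {f g} : L2 mu f -> L2 mu g ->
  sqn (f \- g) = sqn f - 2 * Re <[g, f]> + sqn g.
Proof.
move=> Lf Lg; have := L2norm_sqr_subZ 1 Lf Lg.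
have -> : (fun x => 1 * g x) = g by apply/funext => x; rewrite mul1r.
move=> ->; rewrite (L2innerC Lg Lf) /abs2.
by case: <[g, f]> => a b /=; ring.
Qed.

(** The gap between the two sides is the squared norm of [f + g]. *)
Lemma L2norm_sqrB_le {f g} : L2 mu f -> L2 mu g ->
  sqn (f \- g) <= 2 * sqn f + 2 * sqn g.
Proof.
move=> Lf Lg; have := sqr_ge0 (L2norm mu (f \- (fun x => (-1) * g x))).
rewrite L2norm_sqr_subZ// L2norm_sqrB// (L2innerC Lg Lf) /abs2.
by case: <[g, f]> => a b /=; lra.
Qed.

(** The gap between the two sides is the squared norm of [f - 2 g]. *)
Lemma L2norm_sqr_le_near {f g} : L2 mu f -> L2 mu g ->
  sqn f <= 2 * sqn g + 2 * sqn (f \- g).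
Proof.
move=> Lf Lg; have := sqr_ge0 (L2norm mu (f \- (fun x => 2 * g x))).
rewrite L2norm_sqr_subZ// L2norm_sqrB// (L2innerC Lg Lf) /abs2.
by case: <[g, f]> => a b /=; lra.
Qed.

(** Expanding the squared norm of [f - t <f, g> g] for real [t] gives the quadratic of
    [le_of_quadratic], which also covers a [g] of norm 0. *)
Lemma L2_cauchy_schwarz {f g} : L2 mu f -> L2 mu g ->
  abs2 <[f, g]> <= sqn f * sqn g.
Proof.
move=> Lf Lg; apply: le_of_quadratic; rewrite ?abs2_ge0 ?sqr_ge0// => t.
have := sqr_ge0 (L2norm mu (f \- (fun x => (t%:C%C * <[f, g]>) * g x))).
rewrite L2norm_sqr_subZ//; congr (_ <= _).
by case: <[f, g]> => a b; rewrite /abs2/=; ring.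
Qed.

Lemma L2norm_lt {f} {e : R} : 0 < e -> sqn f < e ^+ 2 -> L2norm mu f < e.
Proof. by move=> e0; rewrite ltr_pXn2r// ?nnegrE ?sqrtr_ge0 ?ltW. Qed.

End InnerProduct.

(** * Square sums as suprema of finite partial sums *)

Section L2Sum.
Context {R : realType} {I : choiceType} {D : set I}.
Implicit Types (c : I -> R[i]) (J : {fset I}).

Lemma ge_l2sum {c J} : [set` J] `<=` D ->
  ((\sum_(k <- J) abs2 (c k))%:E <= l2sum D c)%E.
Proof.
move=> JD; apply: esum_ge; exists [set` J]; first by split.
rewrite fsbig_finite//= set_fsetK -sumEFin.
by under [leRHS]eq_bigr do rewrite sqr_normc.
Qed.

Lemma l2sum_le {c} {b : \bar R} :
  (forall J, [set` J] `<=` D -> ((\sum_(k <- J) abs2 (c k))%:E <= b)%E) ->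
  (l2sum D c <= b)%E.
Proof.
move=> H; apply: ge_ereal_sup => _ [X [finX XD] <-].
rewrite fsbig_finite//=; under eq_bigr do rewrite sqr_normc.
by rewrite sumEFin; apply: H; rewrite fset_setK.
Qed.

Lemma l2sum_gt {c} {b : R} : (b%:E < l2sum D c)%E ->
  exists2 J : {fset I}, [set` J] `<=` D & b < \sum_(k <- J) abs2 (c k).
Proof.
move=> /ereal_sup_gt[_ [X [finX XD] <-]].
rewrite fsbig_finite//=; under eq_bigr do rewrite sqr_normc.
rewrite sumEFin lte_fin => h; exists (fset_set X) => //.
by rewrite fset_setK.
Qed.

End L2Sum.

(** * Finite combinations of a family, and Bessel bounds *)

Section FiniteSums.
Context {R : realType} {d : measure_display} {T : measurableType d}
  {mu : {measure set T -> \bar R}} {I : choiceType} {D : set I}.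
Implicit Types (f g h : T -> R[i]) (F G : I -> T -> R[i]) (J : {fset I}).

Local Notation Re := complex.Re.
Local Notation "<[ f , g ]>" := (L2inner mu f g).
Local Notation sqn f := (L2norm mu f ^+ 2).

Lemma ler_sum_in J (u v : I -> R) : [set` J] `<=` D ->
  (forall k, D k -> u k <= v k) -> \sum_(k <- J) u k <= \sum_(k <- J) v k.
Proof.
by move=> JD uv; rewrite !big_seq; apply: ler_sum => k kJ; exact/uv/JD.
Qed.

Lemma eq_sum_in J (V : nmodType) (u v : I -> V) : [set` J] `<=` D ->
  (forall k, D k -> u k = v k) -> \sum_(k <- J) u k = \sum_(k <- J) v k.
Proof.
by move=> JD uv; apply: eq_big_seq => k kJ; exact/uv/JD.
Qed.

Lemma big_fset_eq_mul J (c : I -> R[i]) k :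
  \sum_(j <- J) c j * (j == k)%:R = if k \in J then c k else 0.
Proof.
case: ifPn => kJ.
  rewrite (bigD1_seq k)//= eqxx mulr1 big1 ?addr0// => j /negbTE ->.
  by rewrite mulr0.
rewrite big_seq big1// => j jJ; case: eqP => [jk|]; last by rewrite mulr0.
by move: kJ; rewrite -jk jJ.
Qed.

(** Padding by zeros brings two combinations to a common index set, where they can be subtracted. *)
Lemma fsum_widen J1 J2 (c : I -> R[i]) F : {subset J1 <= J2} ->
  fsum J1 c F = fsum J2 (fun k => if k \in J1 then c k else 0) F.
Proof.
move=> /fsubsetP sJ; apply/funext => x; rewrite /fsum.
rewrite -(big_fset_incl _ sJ); last first.
  by move=> k _ /negbTE ->; rewrite mul0r.
by apply: eq_big_seq => k ->.
Qed.

Lemma fsumB J (a b : I -> R[i]) F :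
  fsum J a F \- fsum J b F = fsum J (fun k => a k - b k) F.
Proof.
apply/funext => x; rewrite /fsum /= -sumrB.
by apply: eq_bigr => k _; rewrite mulrBl.
Qed.

Section Family.
Context {F : I -> T -> R[i]} (F2 : forall k, D k -> L2 mu (F k)).

Lemma L2_fsum {J} (c : I -> R[i]) : [set` J] `<=` D -> L2 mu (fsum J c F).
Proof.
rewrite /fsum => JD.
have {}JD : forall k, k \in (J : seq I) -> D k by exact: JD.
elim: (J : seq I) JD => [|k s IHs] sD.
  by rewrite (_ : (fun _ => _) = fun=> 0); [exact: L2_0|
    apply/funext => x; rewrite big_nil].
rewrite (_ : (fun _ => _) =
    fun x => c k * F k x + \sum_(j <- s) c j * F j x); last first.
  by apply/funext => x; rewrite big_cons.
apply: L2D; first by apply/L2Z/F2/sD; rewrite inE eqxx.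
by apply: IHs => j js; apply: sD; rewrite inE js orbT.
Qed.

Lemma L2inner_fsuml {J} (c : I -> R[i]) {h} : [set` J] `<=` D -> L2 mu h ->
  <[fsum J c F, h]> = \sum_(k <- J) c k * <[F k, h]>.
Proof.
move=> JD Lh; rewrite /fsum.
(* Membership in [L2] is carried through the induction because additivity of the inner product
   requires it of the tail. *)
suff [] : L2 mu (fun x => \sum_(k <- J) c k * F k x) /\
    <[fun x => \sum_(k <- J) c k * F k x, h]> =
      \sum_(k <- J) c k * <[F k, h]> by [].
have {}JD : forall k, k \in (J : seq I) -> D k by exact: JD.
elim: (J : seq I) JD => [|k s IHs] sD.
  rewrite big_nil (_ : (fun _ => _) = fun=> 0); last first.
    by apply/funext => x; rewrite big_nil.
  split; first exact: L2_0.
  by have := L2innerZl 0 (L2_0 (mu := mu)) Lh; rewrite !mul0r.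
have [|L E] := IHs; first by move=> j js; apply: sD; rewrite inE js orbT.
have Lk : L2 mu (F k) by apply/F2/sD; rewrite inE eqxx.
rewrite (_ : (fun _ => _) =
    fun x => c k * F k x + \sum_(j <- s) c j * F j x); last first.
  by apply/funext => x; rewrite big_cons.
split; first by apply: L2D => //; exact: L2Z.
by rewrite L2innerDl// ?L2innerZl ?big_cons ?E//; exact: L2Z.
Qed.

Lemma Re_sum (s : seq I) (z : I -> R[i]) :
  Re (\sum_(k <- s) z k) = \sum_(k <- s) Re (z k).
Proof.
elim: s => [|k s IHs]; first by rewrite !big_nil.
by rewrite !big_cons -IHs; case: (z k) (\sum_(j <- s) z j) => ? ? [].
Qed.

Lemma abs2_L2innerC {f g} : L2 mu f -> L2 mu g -> abs2 <[g, f]> = abs2 <[f, g]>.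
Proof. by move=> Lf Lg; rewrite (L2innerC Lf Lg) abs2_conj. Qed.

(** Applied with [h] equal to the combination itself, this bounds its squared norm by the
    coefficients and the inner products with [F]; [t] weighs the two. *)
Lemma young_fsum (t : R) {J} (c : I -> R[i]) {h} : [set` J] `<=` D ->
  L2 mu h -> t *+ 2 * Re <[fsum J c F, h]> <=
  t ^+ 2 * (\sum_(k <- J) abs2 (c k)) + \sum_(k <- J) abs2 <[h, F k]>.
Proof.
move=> JD Lh; rewrite L2inner_fsuml// Re_sum !mulr_sumr -big_split/=.
apply: ler_sum_in JD _ => k Dk; rewrite (abs2_L2innerC (F2 _ Dk) Lh).
exact: young_complex.
Qed.

Lemma lin_span_closed_span {h} : lin_span D F h -> closed_span mu D F h.
Proof.
move=> [J JD [c ->]]; split; first exact: L2_fsum.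
move=> e e0; exists (fsum J c F); first by exists J => //; exists c.
apply: L2norm_lt => //; rewrite L2norm_sqrB; try exact: L2_fsum.
by rewrite L2normE; have := exprn_gt0 2 e0; lra.
Qed.

Lemma closed_spanB {f} J (c : I -> R[i]) : [set` J] `<=` D ->
  closed_span mu D F f -> closed_span mu D F (f \- fsum J c F).
Proof.
move=> JD [Lf Kf]; split; first by apply: L2B => //; exact: L2_fsum.
move=> e e0; have [_ [J' JD' [a ->]] fe] := Kf e e0.
exists (fsum J' a F \- fsum J c F).
  exists (J `|` J')%fset.
    by move=> k /=; rewrite in_fsetU => /orP[/JD|/JD'].
  rewrite (fsum_widen J' (J `|` J')%fset) ?(fsum_widen J (J `|` J')%fset c).
  - by rewrite fsumB; eexists.
  - by move=> k kJ; rewrite in_fsetU kJ.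
  - by move=> k kJ; rewrite in_fsetU kJ orbT.
suff -> : f \- fsum J c F \- (fsum J' a F \- fsum J c F) =
    f \- fsum J' a F by [].
by apply/funext => x /=; ring.
Qed.

Lemma closed_span_approx {f} (m x : R) : closed_span mu D F f -> 0 <= m ->
  0 < x -> exists J (a : I -> R[i]), [set` J] `<=` D /\
    m * sqn (f \- fsum J a F) < x.
Proof.
move=> [_ Kf] m0 x0; have [e e0 ex] := exists_sqr_lt m x m0 x0.
have [_ [J JD [a ->]] fe] := Kf e e0; exists J, a; split=> //.
apply: le_lt_trans ex; rewrite ler_wpM2l// lerXn2r ?nnegrE ?sqrtr_ge0 ?ltW//.
Qed.

Context {B : R} (B0 : 0 < B).

Section Synthesis.
Context (spanB : forall h, lin_span D F h -> forall J, [set` J] `<=` D ->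
  \sum_(k <- J) abs2 <[h, F k]> <= B * sqn h).

(** For the combination [h], Young with [t = B] bounds [2 B |h|^2] by
    [B^2 sum |a_k|^2 + sum |<h, F_k>|^2]; the last sum is at most [B |h|^2] and is absorbed on the
    left. *)
Lemma synthesis_le {J} (a : I -> R[i]) : [set` J] `<=` D ->
  sqn (fsum J a F) <= B * \sum_(k <- J) abs2 (a k).
Proof.
move=> JD; have Lh := L2_fsum a JD.
have := young_fsum B a JD Lh; rewrite -L2normE.
have : lin_span D F (fsum J a F) by exists J => //; exists a.
move=> /spanB-/(_ _ JD) h1 h2; rewrite -(ler_pM2l B0).
by move: h1 h2; rewrite expr2; lra.
Qed.

(** Let [S] be the sum on the right. The cross term contributes [- 2 B^-1 S], and by [synthesis_le]
    the subtracted combination has squared norm at most [B^-1 S]. *)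
Lemma residual_le {J f} : [set` J] `<=` D -> L2 mu f ->
  sqn (f \- fsum J (fun k => B^-1%:C%C * <[f, F k]>) F) <=
  sqn f - B^-1 * \sum_(k <- J) abs2 <[f, F k]>.
Proof.
move=> JD Lf; rewrite L2norm_sqrB//; last exact: L2_fsum.
have := synthesis_le (fun k => B^-1%:C%C * <[f, F k]>) JD.
have -> : Re <[fsum J (fun k => B^-1%:C%C * <[f, F k]>) F, f]> =
    B^-1 * \sum_(k <- J) abs2 <[f, F k]>.
  rewrite L2inner_fsuml// Re_sum mulr_sumr.
  apply: eq_sum_in JD _ => k Dk; rewrite (L2innerC Lf (F2 _ Dk)).
  by case: <[f, F k]> => u v; rewrite /abs2 /=; ring.
have -> : \sum_(k <- J) abs2 (B^-1%:C%C * <[f, F k]>) =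
    B^-1 * (B^-1 * \sum_(k <- J) abs2 <[f, F k]>).
  rewrite !mulr_sumr; apply: eq_bigr => k _.
  by case: <[f, F k]> => u v; rewrite /abs2 /=; ring.
by rewrite mulVKf ?gt_eqF//; lra.
Qed.

(** The residual has nonnegative squared norm. This carries the bound [B] from the span of [F] to
    all of [L2] without an orthogonal projection. *)
Lemma finite_bessel {J f} : [set` J] `<=` D -> L2 mu f ->
  \sum_(k <- J) abs2 <[f, F k]> <= B * sqn f.
Proof.
move=> JD Lf; have := le_trans (sqr_ge0 _) (residual_le JD Lf).
by rewrite subr_ge0 mulrC ler_pdivrMr// mulrC.
Qed.

End Synthesis.
End Family.
End FiniteSums.

(** * Coefficients and independence for biorthogonal families *)

Section Biorthogonal.
Context {R : realType} {d : measure_display} {T : measurableType d}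
  {mu : {measure set T -> \bar R}} {I : choiceType} {D : set I}
  {F G : I -> T -> R[i]}.
Context (F2 : forall k, D k -> L2 mu (F k)) (G2 : forall k, D k -> L2 mu (G k)).
Implicit Types (f g h : T -> R[i]) (J : {fset I}).

Local Notation "<[ f , g ]>" := (L2inner mu f g).
Local Notation sqn f := (L2norm mu f ^+ 2).

Lemma L2norm_sub0l f : L2norm mu ((fun=> 0) \- f) = L2norm mu f.
Proof.
rewrite /L2norm; congr Num.sqrt; apply: eq_Rintegral => x _.
by rewrite !sqr_normc /=; case: (f x) => u v; rewrite /abs2/=; ring.
Qed.

Lemma biorthogonalC : biorthogonal mu D F G -> biorthogonal mu D G F.
Proof.
move=> FG j k Dj Dk; rewrite (L2innerC (F2 _ Dk) (G2 _ Dj)) FG// eq_sym.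
by case: (j == k); rewrite /= ?oppr0.
Qed.

Lemma biorthogonal_coef {J k} (c : I -> R[i]) : biorthogonal mu D F G ->
  [set` J] `<=` D -> D k -> <[fsum J c F, G k]> = if k \in J then c k else 0.
Proof.
move=> FG JD Dk; rewrite (L2inner_fsuml F2)//; last exact: G2.
rewrite -big_fset_eq_mul; apply: eq_sum_in JD _ => j Dj.
by rewrite FG.
Qed.

(** Every partial sum whose index set contains [k] has inner product [c k] with [G k], while these
    partial sums tend to 0; Cauchy-Schwarz concludes. *)
Lemma biorthogonal_independent : biorthogonal mu D F G -> l2_independent mu D F.
Proof.
move=> FG c _ c0 k Dk; apply/abs2_le0/(le0_sqr (sqn (G k))).
  exact: sqr_ge0.
move=> e e0; have [J0 J0D sumJ] := c0 e e0.
have JD : [set` (k |` J0)%fset] `<=` D.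
  by move=> j /=; rewrite !inE => /orP[/eqP ->|/J0D].
have /sumJ-/(_ JD) : [set` J0] `<=` [set` (k |` J0)%fset].
  by move=> j /= jJ0; rewrite !inE jJ0 orbT.
have := L2_cauchy_schwarz (L2_fsum F2 c JD) (G2 _ Dk).
rewrite biorthogonal_coef// !inE eqxx /= => CS Ne; apply: le_trans CS _.
rewrite mulrC ler_wpM2l ?sqr_ge0//.
by rewrite -L2norm_sub0l lerXn2r ?nnegrE ?sqrtr_ge0 ?ltW//.
Qed.

End Biorthogonal.

(** * A frame for its closed span, with a biorthogonal family *)

Section BiorthogonalFrame.
Context {R : realType} {d : measure_display} {T : measurableType d}
  {mu : {measure set T -> \bar R}} {I : choiceType} {D : set I}
  {F G : I -> T -> R[i]}.
Context (F2 : forall k, D k -> L2 mu (F k)) (G2 : forall k, D k -> L2 mu (G k)).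
Implicit Types (f g h : T -> R[i]) (J : {fset I}).

Local Notation "<[ f , g ]>" := (L2inner mu f g).
Local Notation sqn f := (L2norm mu f ^+ 2).

Context {A B : R} (A0 : 0 < A) (AB : A <= B).
Context (FG : biorthogonal mu D F G).
Context (frameF : forall f, closed_span mu D F f ->
  ((A * sqn f)%:E <= l2sum D (fun k => <[f, F k]>))%E /\
  (l2sum D (fun k => <[f, F k]>) <= (B * sqn f)%:E)%E).

Let B0 : 0 < B. Proof. exact: lt_le_trans AB. Qed.

Lemma frame_span_le {h} : lin_span D F h -> forall J, [set` J] `<=` D ->
  \sum_(k <- J) abs2 <[h, F k]> <= B * sqn h.
Proof.
move=> /(lin_span_closed_span F2)/frameF[_ hB] J JD.
by have := le_trans (ge_l2sum JD) hB; rewrite lee_fin.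
Qed.

Let besselF {J f} := finite_bessel (J := J) (f := f) F2 B0 (@frame_span_le).

(** Halving [A] makes the lower frame bound strict when [f] has nonzero norm, so some finite partial
    sum already exceeds it. *)
Lemma frame_finite_lower {f} : closed_span mu D F f ->
  exists2 J : {fset I}, [set` J] `<=` D &
    A / 2 * sqn f <= \sum_(k <- J) abs2 <[f, F k]>.
Proof.
move=> Kf; have [f0|fn0] := eqVneq (sqn f) 0.
  by exists fset0 => //; rewrite f0 mulr0 sumr_ge0// => k _; exact: abs2_ge0.
have fp : 0 < sqn f by rewrite lt_def fn0 sqr_ge0.
have : ((A / 2 * sqn f)%:E < l2sum D (fun k => <[f, F k]>))%E.
  apply: lt_le_trans (frameF _ Kf).1; rewrite lte_fin.
  by rewrite ltr_pM2r// ltr_pdivrMr// mulr_natr mulr2n ltrDl.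
by move=> /l2sum_gt[J JD /ltW h]; exists J.
Qed.

(* Replacing [f] by the residual [f - B^-1 sum_(k in J') <f, F_k> F_k], with
   [J'] large enough, shrinks [|f|^2] by the factor [q = 1 - A / (2 B)], while
   the subtracted part has explicit coefficients against [G]; hence a constant
   [M] in the bound can be replaced by [r M + c] with [r < 1]. *)
Lemma biorthogonal_finite_bessel : exists2 C, 0 <= C &
  forall f, closed_span mu D F f -> forall J, [set` J] `<=` D ->
    \sum_(k <- J) abs2 <[f, G k]> <= C * sqn f.
Proof.
(* [s] is the Young parameter, small enough that [(1 + s) q <= r < 1]; [C] is the fixed point of
   [M -> r M + c]. *)
pose q := 1 - A / 2 / B; pose s := (1 - q) / 2; pose r := (1 + q) / 2.
pose c := (1 + s^-1) * B^-1; pose C := c / (1 - r).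
have AB2 : 0 < A / 2 / B <= 2^-1.
  have A20 : 0 < A / 2 by rewrite divr_gt0.
  have A2B : A / 2 <= 2^-1 * B by rewrite mulrC ler_pM2l ?invr_gt0.
  by rewrite divr_gt0//= ler_pdivrMr.
have q01 : 2^-1 <= q < 1 by rewrite /q; lra.
have s0 : 0 < s by rewrite /s; lra.
have r01 : 0 < r < 1 by rewrite /r; lra.
have c0 : 0 < c by rewrite mulr_gt0 ?invr_gt0// addr_gt0 ?invr_gt0.
have C0 : 0 <= C by rewrite divr_ge0 ?(ltW c0)//; lra.
have Cfix : r * C + c = C by rewrite /C; field; lra.
(* Cauchy-Schwarz supplies the crude initial constant [M]. It depends on [J], but after [n] rounds
   it enters only as [r ^+ n * M], so the limit constant [C] does not. *)
exists C => // f Kf J JD; pose M := \sum_(k <- J) sqn (G k).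
have M0 : 0 <= M by rewrite sumr_ge0// => k _; exact: sqr_ge0.
rewrite -subr_le0; apply: (le0_geometric r (M * sqn f)); first lra.
move=> n; rewrite lerBlDr mulrA -mulrDl.
(* [f] is generalized because the induction hypothesis is applied to the residual [f \- u]. *)
elim: n f Kf => [|n IHn] f Kf.
  rewrite expr0 mul1r; apply: (@le_trans _ _ (M * sqn f)); last first.
    by rewrite ler_wpM2r ?sqr_ge0// lerDl.
  rewrite mulr_suml; apply: ler_sum_in JD _ => k Dk.
  by rewrite mulrC; apply: L2_cauchy_schwarz => //; [exact: Kf.1|exact: G2].
have [J' J'D lowJ'] := frame_finite_lower Kf.
pose a k := B^-1%:C%C * <[f, F k]>; pose u := fsum J' a F.
have Lu : L2 mu u by exact: (L2_fsum F2).
have Lf := Kf.1.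
have resq : sqn (f \- u) <= q * sqn f.
  apply: le_trans (residual_le F2 B0 (@frame_span_le) J'D Lf) _.
  have : B^-1 * (A / 2 * sqn f) <= B^-1 * \sum_(k <- J') abs2 <[f, F k]>.
    by rewrite ler_wpM2l// invr_ge0 ltW.
  by rewrite /q; lra.
have sumu : \sum_(k <- J) abs2 <[u, G k]> <= B^-1 * sqn f.
  apply: (@le_trans _ _ (\sum_(k <- J) B^-1 ^+ 2 * abs2 <[f, F k]>)).
    apply: ler_sum_in JD _ => k Dk.
    (* By biorthogonality [<u, G_k>] is [a k] or 0, according to whether [k] lies in [J']. *)
    rewrite (biorthogonal_coef F2 G2 a FG J'D Dk).
    have -> : B^-1 ^+ 2 * abs2 <[f, F k]> = abs2 (a k).
      by rewrite /a; case: <[f, F k]> => x y; rewrite /abs2/=; ring.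
    by case: ifP => // _; rewrite /abs2/= expr0n addr0 -/(abs2 (a k)) abs2_ge0.
  rewrite -mulr_sumr expr2 -mulrA ler_wpM2l ?invr_ge0 ?(ltW B0)//.
  by rewrite ler_pdivrMl//; exact: besselF.
have IH := IHn _ (closed_spanB F2 J' a J'D Kf).
have step : \sum_(k <- J) abs2 <[f, G k]> <=
    (1 + s) * \sum_(k <- J) abs2 <[f \- u, G k]> +
    (1 + s^-1) * \sum_(k <- J) abs2 <[u, G k]>.
  rewrite !mulr_sumr -big_split/=; apply: ler_sum_in JD _ => k Dk.
  rewrite (L2innerBl Lf Lu (G2 _ Dk)).
  have {1}-> : <[f, G k]> = (<[f, G k]> - <[u, G k]>) + <[u, G k]>.
    by rewrite subrK.
  exact: abs2D_le.
apply: le_trans step _.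
set M' := r ^+ n * M + C in IH.
have M'0 : 0 <= M' by rewrite addr_ge0// mulr_ge0// exprn_ge0//; lra.
have h1 : \sum_(k <- J) abs2 <[f \- u, G k]> <= M' * q * sqn f.
  by apply: le_trans IH _; rewrite -mulrA ler_wpM2l.
have h2 : (1 + s) * \sum_(k <- J) abs2 <[f \- u, G k]> <= r * M' * sqn f.
  apply: (@le_trans _ _ ((1 + s) * (M' * q * sqn f))).
    by rewrite ler_wpM2l//; lra.
  rewrite mulrA ler_wpM2r ?sqr_ge0// mulrCA mulrC ler_wpM2r//.
  (* [(1 + s) q <= r] amounts to [0 <= (1 - q) ^+ 2]. *)
  by rewrite /s /r; nra.
have h3 : (1 + s^-1) * \sum_(k <- J) abs2 <[u, G k]> <= c * sqn f.
  rewrite /c -mulrA ler_wpM2l// addr_ge0// invr_ge0 ltW//.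
apply: le_trans (lerD h2 h3) _; rewrite -mulrDl ler_wpM2r ?sqr_ge0//.
by rewrite /M' mulrDr -addrA Cfix exprS mulrA.
Qed.

Lemma biorthogonal_dual_expansion :
  dual_expansion mu D (closed_span mu D F) F G.
Proof.
move=> f Kf e e0; have [C C0 CJ] := biorthogonal_finite_bessel.
(* For [v] in the closed span, [v] minus its partial expansion has squared norm at most
   [2 |v|^2 + 2 B C |v|^2]. *)
have [|J0 [a [J0D near]]] := closed_span_approx (2 + 2 * (B * C)) (e ^+ 2) Kf _
  (exprn_gt0 2 e0); first by rewrite addr_ge0// !mulr_ge0// ltW.
exists J0 => // J sJ JD; apply: L2norm_lt => //; apply: le_lt_trans near.
set g := fsum J0 a F; set v := f \- g.
have Lg : L2 mu g by exact: (L2_fsum F2).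
have Kv : closed_span mu D F v by exact: (closed_spanB F2).
(* Once [J] contains [J0], the expansion reproduces [g] exactly, so only the error for [v]
   remains. *)
have -> : f \- fsum J (fun k => <[f, G k]>) F =
    v \- fsum J (fun k => <[v, G k]>) F.
  have -> : fsum J (fun k => <[v, G k]>) F =
      fsum J (fun k => <[f, G k]>) F \- g.
    rewrite /g (fsum_widen J0 J)// fsumB; apply/funext => x.
    apply: eq_sum_in JD _ => k Dk; rewrite (L2innerBl Kf.1 Lg (G2 _ Dk)).
    by rewrite (biorthogonal_coef F2 G2 a FG J0D Dk).
  by apply/funext => x; rewrite /v /=; ring.
apply: le_trans (L2norm_sqrB_le Kv.1 (L2_fsum F2 _ JD)) _.
rewrite [leRHS]mulrDl lerD2l -!mulrA ler_wpM2l//.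
apply: le_trans (synthesis_le F2 B0 (@frame_span_le) _ JD) _.
by rewrite ler_wpM2l ?(ltW B0)//; exact: CJ.
Qed.

Lemma frame_bessel : bessel mu D F.
Proof.
by exists B => f Lf; apply: l2sum_le => J JD; rewrite lee_fin; exact: besselF.
Qed.

(** For the combination [h], [b k = <h, F_k>], so the Bessel bound of [F] gives
    [sum |b_k|^2 <= B |h|^2]. Young with [t = B^-1] then leaves [B^-1 |h|^2] on the left. *)
Lemma biorthogonal_span_lower {J} (b : I -> R[i]) : [set` J] `<=` D ->
  sqn (fsum J b G) <= B * \sum_(k <- J) abs2 <[fsum J b G, G k]>.
Proof.
move=> JD; have Lg := L2_fsum G2 b JD; have bF := besselF JD Lg.
have B0i : 0 < B^-1 by rewrite invr_gt0.
have := young_fsum G2 B^-1 b JD Lg; rewrite -L2normE.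
have <- : \sum_(k <- J) abs2 <[fsum J b G, F k]> = \sum_(k <- J) abs2 (b k).
  apply: eq_big_seq => k kJ.
  have GF := biorthogonalC F2 G2 FG.
  by rewrite (biorthogonal_coef G2 F2 b GF JD (JD _ kJ)) kJ.
rewrite -(ler_pM2l (exprn_gt0 2 B0i)) in bF.
rewrite -ler_pdivrMl//.
have : B^-1 ^+ 2 * (B * sqn (fsum J b G)) = B^-1 * sqn (fsum J b G).
  by field; rewrite gt_eqF.
by move: bF; lra.
Qed.

(** The Bessel property of [G] gives the upper bound, and also lets the lower bound pass from finite
    combinations to their closure. *)
Lemma biorthogonal_riesz_basis : bessel mu D G -> subspace_riesz_basis mu D G.
Proof.
move=> [B' besG]; split; last first.
  exact: (biorthogonal_independent G2 F2 (biorthogonalC F2 G2 FG)).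
have B4 : 0 < (B *+ 4)^-1 by rewrite invr_gt0 pmulrn_lgt0.
(* The maximum secures the required order of the frame bounds, since nothing is known of the size or
   sign of [B']. *)
exists (B *+ 4)^-1, (Num.max B' (B *+ 4)^-1); split=> //.
  by rewrite le_max lexx orbT.
move=> g Kg; have Lg := Kg.1; split; last first.
  apply: le_trans (besG g Lg) _; rewrite lee_fin ler_wpM2r ?sqr_ge0//.
  by rewrite le_max lexx.
have fin : l2sum D (fun k => <[g, G k]>) \is a fin_num.
  rewrite ge0_fin_numE; first exact: le_lt_trans (besG g Lg) (ltry _).
  by apply: esum_ge0 => k _; rewrite lee_fin sqr_ge0.
have := @ge_l2sum _ _ D (fun k => <[g, G k]>).
rewrite -(fineK fin) => sub; rewrite lee_fin mulrC ler_pdivrMr ?pmulrn_lgt0//.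
set S := fine _ in sub *; rewrite -subr_le0.
(* For an approximant [h], [|g|^2 <= 2 |h|^2 + 2 |g - h|^2] and
   [|h|^2 <= B (2 S + 2 |B'| |g - h|^2)]; together [|g|^2 <= 4 B S + m |g - h|^2]. *)
pose m := B *+ 4 * `|B'| + 2.
have m0 : 0 <= m by rewrite addr_ge0// mulr_ge0// mulrn_wge0// ltW.
rewrite leNgt; apply/negP => /(closed_span_approx m _ Kg m0)[J [b [JD]]].
apply/negP; rewrite -leNgt.
set h := fsum J b G; have Lh : L2 mu h by exact: (L2_fsum G2).
have LB := L2B Lg Lh.
have h1 := L2norm_sqr_le_near Lg Lh.
have h2 := biorthogonal_span_lower b JD; rewrite -/h in h2.
have h3 : \sum_(k <- J) abs2 <[h, G k]> <=
    2 * \sum_(k <- J) abs2 <[g, G k]> + 2 * \sum_(k <- J) abs2 <[g \- h, G k]>.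
  rewrite !mulr_sumr -big_split/=; apply: ler_sum_in JD _ => k Dk.
  rewrite (L2innerBl Lg Lh (G2 _ Dk)).
  have := abs2D_le 1 <[g, G k]> (<[h, G k]> - <[g, G k]>) ltr01.
  rewrite [_ + (_ - _)]addrC subrK invr1 => /le_trans; apply.
  by case: <[g, G k]> <[h, G k]> => x y [x' y']; rewrite /abs2/=; lra.
have h4 := sub J JD; rewrite lee_fin in h4.
have h5 : \sum_(k <- J) abs2 <[g \- h, G k]> <= `|B'| * sqn (g \- h).
  have := le_trans (ge_l2sum JD) (besG _ LB).
  rewrite lee_fin => /le_trans; apply.
  by rewrite ler_wpM2r ?sqr_ge0// ler_norm.
have h6 : B * \sum_(k <- J) abs2 <[h, G k]> <=
    B * (2 * S + 2 * (`|B'| * sqn (g \- h))).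
  by rewrite ler_wpM2l ?(ltW B0)//; lra.
rewrite /m; set N := sqn (g \- h) in h1 h3 h5 h6 *.
by lra.
Qed.

End BiorthogonalFrame.

(** * Left translation preserves L2 *)

Section TranslateL2.
Context {R : realType} {G : topGroupType}.

Lemma continuous_mulgl (a : G) : continuous (fun x : G => (a * x)%g).
Proof.
move=> x; apply: (@cvg_comp _ _ _ (fun y : G => (a, y)) (fun p => (p.1 * p.2)%g)
  _ (nbhs (a, x))); last exact: (mulg_continuous (a, x)).
by apply: cvg_pair; [exact: cvg_cst|exact: cvg_id].
Qed.

Lemma measurable_mulgl (a : G) : measurable_fun [set: borelType G]
  ((fun x => (a * x)%g) : borelType G -> borelType G).
Proof.
apply: (@measurability _ _ (borelType G) (borelType G) setT _ (@open G) erefl).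
move=> _ [U oU <-]; rewrite setTI.
apply: sub_sigma_algebra; move: U oU; exact/continuousP/continuous_mulgl.
Qed.

(** Left invariance makes [mu] its own image under [x -> a^-1 x], so a change of variables leaves
    the integral of the squared modulus unchanged. *)
Lemma L2_ltrans {mu : {measure set (borelType G) -> \bar R}} (a : G)
  {f : G -> R[i]} : left_haar mu -> L2 mu f ->
  L2 mu (ltrans a f : borelType G -> R[i]).
Proof.
move=> haar [mr mi fin]; have ma := measurable_mulgl a^-1%g.
split; first exact: measurableT_comp mr ma.
  exact: measurableT_comp mi ma.
pose t : borelType G -> borelType G := fun x => (a^-1 * x)%g.
pose t_mixin := isMeasurableFun.Build _ _ _ _ t ma.
pose tm : {mfun borelType G >-> borelType G} := HB.pack t t_mixin.
have pushE A : measurable A -> mu A = pushforward mu tm A.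
  (* The preimage of [A] under [t] is the translate of [A] by [a]. *)
  move=> mA; rewrite /pushforward -[LHS](haar_left_invariant haar a mA).
  congr (mu _); apply/seteqP; split=> [_ [x Ax <-]|x /= Ax] /=.
    by rewrite /t mulKg.
  by exists (a^-1 * x)%g => //; rewrite mulVKg.
pose h (y : borelType G) := (ComplexField.Normc.normc (f y) ^+ 2)%:E.
have mh : measurable_fun [set: borelType G] h.
  have -> : h = EFin \o (fun y =>
      complex.Re (f y) ^+ 2 + complex.Im (f y) ^+ 2).
    by apply/funext => y; rewrite /h sqr_normc.
  apply/measurable_EFinP; apply: measurable_funD; exact: measurable_funX.
have := @ge0_integral_pushforward _ _ _ _ R _ ma mu setT h measurableT mh.
rewrite preimage_setT => <-; last by move=> y _; rewrite lee_fin sqr_ge0.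
suff <- : (\int[mu]_x h x = \int[pushforward mu tm]_x h x)%E by [].
by apply: eq_measure_integral => A mA _; exact: pushE.
Qed.

End TranslateL2.

(** [subspace_dual] includes the Bessel property of both families, so the expansion is stated by
    itself and that property of the translates of [psi] is a premise of the rest. Biorthogonality
    controls them only on the closed span of the translates of [phi]. *)
Theorem theorem4p3 (R : realType) (G : topGroupType) (hG : sc_lc_group G)
    (mu : {measure set (borelType G) -> \bar R}) (hmu : left_haar mu)
    (Gam : set G) (hGam : closed_discrete_abelian_subgroup Gam)
    (phi : G -> R[i]) (phiL2 : L2 mu phi)
    (phi_supp : compactly_supported mu phi)
    (phi_riesz : subspace_riesz_basis mu Gam (orbit_family phi))
    (psi : G -> R[i]) (psiL2 : L2 mu psi)
    (phi_psi : biorthogonal mu Gam (orbit_family phi) (orbit_family psi)) :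
  dual_expansion mu Gam (translate_space mu Gam phi)
    (orbit_family phi) (orbit_family psi) /\
  (bessel mu Gam (orbit_family psi) ->
   subspace_dual mu Gam (translate_space mu Gam phi)
     (orbit_family phi) (orbit_family psi) /\
   subspace_riesz_basis mu Gam (orbit_family psi)).
Proof.
have [[A [B [A0 AB frame]]] _] := phi_riesz.
have phi2 k : Gam k -> L2 mu (orbit_family phi k) by move=> _; exact: L2_ltrans.
have psi2 k : Gam k -> L2 mu (orbit_family psi k) by move=> _; exact: L2_ltrans.
have dual := biorthogonal_dual_expansion phi2 psi2 A0 AB phi_psi frame.
split=> // psiB; split; last first.
  exact: (biorthogonal_riesz_basis phi2 psi2 A0 AB phi_psi frame psiB).
by split; [exact: (frame_bessel phi2 A0 AB frame)|exact: psiB|exact: dual].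
Qed.
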